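(* Let $A\in\mathbb{R}^{s\times d}$, $b^\delta\in\mathbb{R}^s$, $f(u)=\frac12\|Au-b^\delta\|^2$ for $u\in\mathbb{R}^d$. Let $h:\mathbb{R}^{d'}\to\mathbb{R}\cup\{\infty\}$ be a proper, convex, lower semicontinuous function and let $W\in\mathbb{R}^{d'\times d}$ be such that there exists $u_*\in\mathbb{R}^d$ with $Wu_*\in\operatorname{relint}(\operatorname{dom}(h))$. Let $S\in\mathbb{R}^{s\times s}$ and $P\in\mathbb{R}^{d\times d}$ be symmetric positive definite matrices satisfying $$P^{-1}A^T=A^TS^{-1},$$ and suppose that the problem $$\min_{u\in\mathbb{R}^d}\ \frac12\|Au-b^\delta\|_{S^{-1}}^2+h(Wu)\qquad(\ast)$$ has at least one solution. Let $\{(u_n,v_n^0)\}_{n\in\mathbb{N}}$ be the primal-dual sequence generated by the PNPD method (defined in the context) with constant step lengths $\alpha\in\left(0,\|P^{-1}A^TA\|^{-1}\right]$ and $\beta\in(0,\|W\|^{-2})$, with an integer $k_{\max}\ge 1$ and with inertial parameters $\gamma_n\ge 0$. Suppose that $$\sum_{n=0}^\infty\gamma_n\|u_n-u_{n-1}\|<\infty .$$ Then: (i) the sequence $\{(u_n,v_n^0)\}_{n\in\mathbb{N}}$ is bounded; (ii) the primal sequence $\{u_n\}_{n\in\mathbb{N}}$ converges to a solution of problem $(\ast)$.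
   Context: $\|\cdot\|$ is the Euclidean norm on vectors and the induced (spectral) norm on matrices; for a symmetric positive definite matrix $M$, $\|u\|_M=\sqrt{u^TMu}$. For a function $\varphi$ with values in $\mathbb{R}\cup\{\infty\}$, $\operatorname{dom}(\varphi)=\{x:\varphi(x)<\infty\}$, and $\operatorname{relint}$ denotes the relative interior. The convex conjugate of $h$ is $h^*(v)=\sup_{w\in\mathbb{R}^{d'}}\langle v,w\rangle-h(w)$. For $\gamma>0$ and a proper convex lower semicontinuous $\varphi$, $\operatorname{prox}_{\gamma\varphi}(a)=\arg\min_{u}\varphi(u)+\frac1{2\gamma}\|u-a\|^2$. The PNPD (Preconditioned Nested Primal-Dual) method: given $u_0\in\mathbb{R}^d$, a symmetric positive definite $P\in\mathbb{R}^{d\times d}$, $\alpha,\beta>0$, an integer $k_{\max}\ge1$ and a sequence $\{\gamma_n\}_{n\in\mathbb{N}}\subseteq\mathbb{R}_{\ge0}$, set $u_{-1}=u_0$ and $v_0^0=0\in\mathbb{R}^{d'}$. For $n=0,1,2,\dots$ compute $$\bar u_n=u_n+\gamma_n(u_n-u_{n-1}),\qquad u_{n+\frac12}=\bar u_n-\alpha P^{-1}\nabla f(\bar u_n),\quad\text{where }\nabla f(u)=A^T(Au-b^\delta);$$ then for $k=0,1,\dots,k_{\max}-1$ compute $$u_n^k=u_{n+\frac12}-\alpha W^Tv_n^k,\qquad v_n^{k+1}=\operatorname{prox}_{\beta\alpha^{-1}h^*}\left(v_n^k+\beta\alpha^{-1}Wu_n^k\right);$$ finally set $$v_{n+1}^0=v_n^{k_{\max}},\qquad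 u_n^{k_{\max}}=u_{n+\frac12}-\alpha W^Tv_n^{k_{\max}},\qquad u_{n+1}=\frac1{k_{\max}}\sum_{j=1}^{k_{\max}}u_n^j .$$ *)

(* Defs.v *)
From HB Require Import structures.
From mathcomp Require Import all_boot all_order all_algebra.
From mathcomp Require Import all_classical all_reals all_analysis.

Set Implicit Arguments.
Unset Strict Implicit.
Unset Printing Implicit Defensive.

Import Order.TTheory GRing.Theory Num.Theory.
Import numFieldNormedType.Exports.

Local Open Scope classical_set_scope.
Local Open Scope ring_scope.

(* The library norm on matrices is the entrywise sup norm; it induces the
   topology used for limits and lower semicontinuity, which is also the
   Euclidean one.  All norms written below are [enorm] or derived from it. *)

Definition dotp {R : realType} {n : nat} (u v : 'cV[R]_n) : R :=
  \sum_(i < n) u i 0 * v i 0.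

Definition enorm {R : realType} {n : nat} (u : 'cV[R]_n) : R :=
  Num.sqrt (dotp u u).

(* For M = 0 (or an empty matrix) this is 0, and the extended-real inverse
   [((opnorm M)%:E^-1)%E] is then +oo: step-length bounds 1/||M|| stated with
   that inverse impose no upper bound when M = 0. *)
Definition opnorm {R : realType} {m n : nat} (M : 'M[R]_(m, n)) : R :=
  sup [set enorm (M *m x) | x in [set x : 'cV[R]_n | enorm x <= 1]].

Definition spd {R : realType} {n : nat} (M : 'M[R]_n) : Prop :=
  M^T = M /\ forall u : 'cV[R]_n, u != 0 -> 0 < (u^T *m M *m u) 0 0.

Definition wnorm {R : realType} {n : nat} (M : 'M[R]_n) (u : 'cV[R]_n) : R :=
  Num.sqrt ((u^T *m M *m u) 0 0).

Definition edom {R : realType} {T : Type} (phi : T -> \bar R) : set T :=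
  [set x | (phi x < +oo)%E].

Definition eproper {R : realType} {T : Type} (phi : T -> \bar R) : Prop :=
  (forall x, phi x != -oo%E) /\ edom phi !=set0.

(* The library's [convex_function] only covers real-valued functions.  Since
   0 * +oo = 0 in \bar R, the cases t = 0 and t = 1 hold trivially. *)
Definition econvex {R : realType} {n : nat} (phi : 'cV[R]_n -> \bar R) : Prop :=
  forall (x y : 'cV[R]_n) (t : R), 0 <= t <= 1 ->
    (phi (t *: x + (1 - t) *: y)%R <= t%:E * phi x + (1 - t)%:E * phi y)%E.

Definition affine_hull {R : realType} {n : nat} (C : set 'cV[R]_n) :
    set 'cV[R]_n :=
  [set x | exists (m : nat) (c : 'I_m -> R) (y : 'I_m -> 'cV[R]_n),
     [/\ forall i, C (y i), \sum_(i < m) c i = 1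
       & x = \sum_(i < m) c i *: y i]].

Definition relint {R : realType} {n : nat} (C : set 'cV[R]_n) :
    set 'cV[R]_n :=
  [set x | C x /\ exists2 e : R, 0 < e &
     forall y, affine_hull C y -> enorm (y - x) < e -> C y].

Definition conjugate {R : realType} {n : nat} (h : 'cV[R]_n -> \bar R)
    (v : 'cV[R]_n) : \bar R :=
  ereal_sup [set ((dotp v w)%:E - h w)%E | w in [set: 'cV[R]_n]].

Definition is_argmin {R : realType} {T : Type} (F : T -> \bar R) (x : T) :
    Prop :=
  forall y, (F x <= F y)%E.

(* [xget] picks the minimizer, which is unique when [phi] is proper, convex
   and lower semicontinuous and [0 < g]; it returns 0 if there is none. *)
Definition prox {R : realType} {n : nat} (g : R) (phi : 'cV[R]_n -> \bar R)
    (a : 'cV[R]_n) : 'cV[R]_n :=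
  xget 0 [set p | is_argmin
    (fun u => phi u + ((2 * g)^-1 * enorm (u - a) ^+ 2)%:E)%E p].

Definition lsq {R : realType} {s d : nat} (A : 'M[R]_(s, d)) (b : 'cV[R]_s)
    (u : 'cV[R]_d) : R :=
  2^-1 * enorm (A *m u - b) ^+ 2.

Definition grad_lsq {R : realType} {s d : nat} (A : 'M[R]_(s, d))
    (b : 'cV[R]_s) (u : 'cV[R]_d) : 'cV[R]_d :=
  A^T *m (A *m u - b).

(* Second-order expansion: [grad_lsq A b] is the gradient of [lsq A b]. *)
Lemma lsq_expansion {R : realType} {s d : nat} (A : 'M[R]_(s, d))
    (b : 'cV[R]_s) (u x : 'cV[R]_d) :
  lsq A b (u + x) =
  lsq A b u + dotp (grad_lsq A b u) x + 2^-1 * enorm (A *m x) ^+ 2.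
Proof.
have dotpE n (a c : 'cV[R]_n) : dotp a c = (a^T *m c) 0 0.
  by rewrite mxE; apply: eq_bigr => i _; rewrite mxE.
have sqE n (a : 'cV[R]_n) : enorm a ^+ 2 = dotp a a.
  by rewrite sqr_sqrtr// sumr_ge0// => i _; rewrite -expr2 sqr_ge0.
have dotpC n (a c : 'cV[R]_n) : dotp a c = dotp c a.
  by apply: eq_bigr => i _; rewrite mulrC.
have dotpDl n (a c e : 'cV[R]_n) : dotp (a + c) e = dotp a e + dotp c e.
  by rewrite !dotpE linearD /= mulmxDl mxE.
have gradE : dotp (grad_lsq A b u) x = dotp (A *m u - b) (A *m x).
  by rewrite !dotpE /grad_lsq trmx_mul trmxK mulmxA.
rewrite /lsq !sqE gradE mulmxDr addrAC.
move: (A *m u - b) (A *m x) => r y.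
rewrite dotpDl (dotpC _ r) (dotpC _ y) !dotpDl (dotpC _ y r).
rewrite !mulrDr -!addrA; congr (_ + _).
by rewrite addrA -mulrDl -[2^-1]div1r -splitr !mul1r.
Qed.

Definition pnpd_objective {R : realType} {s d d' : nat} (A : 'M[R]_(s, d))
    (b : 'cV[R]_s) (S : 'M[R]_s) (W : 'M[R]_(d', d)) (h : 'cV[R]_d' -> \bar R)
    (u : 'cV[R]_d) : \bar R :=
  ((2^-1 * wnorm (invmx S) (A *m u - b) ^+ 2)%:E + h (W *m u))%E.

(* [u n.-1] is u_{n-1}; as 0.-1 = 0, it encodes u_{-1} = u_0. *)
Definition pnpd_bar {R : realType} {d : nat} (gam : nat -> R)
    (u : nat -> 'cV[R]_d) (n : nat) : 'cV[R]_d :=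
  u n + gam n *: (u n - u n.-1).

Definition pnpd_half {R : realType} {s d : nat} (A : 'M[R]_(s, d))
    (b : 'cV[R]_s) (P : 'M[R]_d) (alpha : R) (gam : nat -> R)
    (u : nat -> 'cV[R]_d) (n : nat) : 'cV[R]_d :=
  pnpd_bar gam u n
    - alpha *: (invmx P *m grad_lsq A b (pnpd_bar gam u n)).

(* The inner primal iterate u_n^k. *)
Definition pnpd_inner {R : realType} {s d d' : nat} (A : 'M[R]_(s, d))
    (b : 'cV[R]_s) (W : 'M[R]_(d', d)) (P : 'M[R]_d) (alpha : R)
    (gam : nat -> R) (u : nat -> 'cV[R]_d) (v : nat -> nat -> 'cV[R]_d')
    (n k : nat) : 'cV[R]_d :=
  pnpd_half A b P alpha gam u n - alpha *: (W^T *m v n k).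

(* [u n] is u_n and [v n k] is v_n^k for k <= kmax (the values of [v n] beyond
   kmax are irrelevant).  The starting point u_0 is [u 0], left arbitrary. *)
Record pnpd_sequence {R : realType} {s d d' : nat} (A : 'M[R]_(s, d))
    (b : 'cV[R]_s) (W : 'M[R]_(d', d)) (h : 'cV[R]_d' -> \bar R)
    (P : 'M[R]_d) (alpha beta : R) (kmax : nat) (gam : nat -> R)
    (u : nat -> 'cV[R]_d) (v : nat -> nat -> 'cV[R]_d') : Prop := {
  pnpd_dual_init : v 0%N 0%N = 0 ;
  pnpd_dual_step : forall n k, (k < kmax)%N ->
    v n k.+1 =
      prox (beta / alpha) (conjugate h)
        (v n k + (beta / alpha) *:
           (W *m pnpd_inner A b W P alpha gam u v n k)) ;
  pnpd_dual_next : forall n, v n.+1 0%N = v n kmax ;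
  pnpd_primal_next : forall n,
    u n.+1 = kmax%:R^-1 *:
      \sum_(1 <= j < kmax.+1) pnpd_inner A b W P alpha gam u v n j
}.

(* Main.v *)
(* Since P^-1 A^T = A^T S^-1, the preconditioned gradient step is a plain
   gradient step for the weighted least-squares term, whose Hessian is
   Q = A^T S^-1 A with alpha Q <= I.  By Fenchel duality (an algebraic
   Hahn-Banach extension, made possible by the relative interior condition) a
   solution x of the problem comes with a dual vector y in the subdifferential
   of h at W x such that grad x + W^T y = 0.  Every inner step does not
   increase
     |u_n^k - x|^2 + D(v_n^k - y),
     D(z) = (alpha^2 / beta) |z|^2 - alpha^2 |W^T z|^2,
   beyond the value |bar u_n - x|^2 + D(v_n^{k-1} - y), up to a residual that
   controls |v_n^k - v_n^{k-1}| and |u_n^k - bar u_n|.  Summing over k and using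
   the convexity of |.|^2, the energy
     E_n = sqrt (kmax |u_n - x|^2 + D(v_n^0 - y))
   satisfies E_{n+1} <= E_n + eps_n with summable eps_n; hence it converges, the
   iterates are bounded and the residuals vanish.  Every limit along an
   ultrafilter is therefore again a saddle point, and the energy relative to
   that point converges to 0. *)

Require Import Defs.
From HB Require Import structures.
From mathcomp Require Import all_boot all_order all_algebra.
From mathcomp Require Import all_classical all_reals all_analysis.
From mathcomp Require Import ring lra.

Set Implicit Arguments.
Unset Strict Implicit.
Unset Printing Implicit Defensive.

Import Order.TTheory GRing.Theory Num.Theory.
Import numFieldNormedType.Exports.

Local Open Scope classical_set_scope.
Local Open Scope ring_scope.

(** * Euclidean norm and operator norm *)

Section euclidean.
Context {R : realType}.

Lemma dotpC n (x y : 'cV[R]_n) : dotp x y = dotp y x.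
Proof. by apply: eq_bigr => i _; rewrite mulrC. Qed.

Lemma dotpDl n (x y z : 'cV[R]_n) : dotp (x + y) z = dotp x z + dotp y z.
Proof. by rewrite -big_split; apply: eq_bigr => i _; rewrite mxE mulrDl. Qed.

Lemma dotpDr n (x y z : 'cV[R]_n) : dotp x (y + z) = dotp x y + dotp x z.
Proof. by rewrite dotpC dotpDl !(dotpC x). Qed.

Lemma dotpZl n a (x y : 'cV[R]_n) : dotp (a *: x) y = a * dotp x y.
Proof. by rewrite mulr_sumr; apply: eq_bigr => i _; rewrite mxE mulrA. Qed.

Lemma dotpZr n a (x y : 'cV[R]_n) : dotp x (a *: y) = a * dotp x y.
Proof. by rewrite dotpC dotpZl dotpC. Qed.

Lemma dotpNl n (x y : 'cV[R]_n) : dotp (- x) y = - dotp x y.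
Proof. by rewrite -scaleN1r dotpZl mulN1r. Qed.

Lemma dotpNr n (x y : 'cV[R]_n) : dotp x (- y) = - dotp x y.
Proof. by rewrite dotpC dotpNl dotpC. Qed.

Lemma dotp0l n (x : 'cV[R]_n) : dotp 0 x = 0.
Proof. by rewrite -(scale0r 0) dotpZl mul0r. Qed.

Definition dotpE := (dotpDl, dotpDr, dotpNl, dotpNr, dotpZl, dotpZr).

Lemma dotp_mxE n (x y : 'cV[R]_n) : dotp x y = (x^T *m y) 0 0.
Proof. by rewrite mxE; apply: eq_bigr => i _; rewrite mxE. Qed.

Lemma dotp_mull m n (M : 'M[R]_(m, n)) x y :
  dotp (M *m x) y = dotp x (M^T *m y).
Proof. by rewrite !dotp_mxE trmx_mul mulmxA. Qed.

Lemma dotp_suml n I r (F : I -> 'cV[R]_n) y :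
  dotp (\sum_(i <- r) F i) y = \sum_(i <- r) dotp (F i) y.
Proof.
elim/big_rec2: _ => [|i a b _ <-]; first exact: dotp0l.
by rewrite dotpDl.
Qed.

Lemma dotp_ge0 n (x : 'cV[R]_n) : 0 <= dotp x x.
Proof. by apply: sumr_ge0 => i _; rewrite -expr2 sqr_ge0. Qed.

Lemma dotp_eq0 n (x : 'cV[R]_n) : dotp x x = 0 -> x = 0.
Proof.
move=> /eqP; rewrite psumr_eq0 => [/allP x0|i _]; last first.
  by rewrite -expr2 sqr_ge0.
apply/colP => i; rewrite mxE; apply/eqP.
by have := x0 i (mem_index_enum _); rewrite mulf_eq0 orbb.
Qed.

Lemma enorm_ge0 n (x : 'cV[R]_n) : 0 <= enorm x.
Proof. exact: sqrtr_ge0. Qed.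

Lemma enorm_sqr n (x : 'cV[R]_n) : enorm x ^+ 2 = dotp x x.
Proof. by rewrite sqr_sqrtr// dotp_ge0. Qed.

Lemma enorm_eq0 n (x : 'cV[R]_n) : enorm x = 0 -> x = 0.
Proof. by move=> x0; apply: dotp_eq0; rewrite -enorm_sqr x0 expr0n. Qed.

Lemma enormZ n a (x : 'cV[R]_n) : enorm (a *: x) = `|a| * enorm x.
Proof.
by rewrite /enorm dotpZl dotpZr mulrA sqrtrM -?expr2 ?sqr_ge0// sqrtr_sqr.
Qed.

Lemma enorm0 n : enorm (0 : 'cV[R]_n) = 0.
Proof. by rewrite /enorm dotp0l sqrtr0. Qed.

(** Expanding the square of [dotp y y *: x - dotp x y *: y] gives [dotp y y] times the
    Cauchy-Schwarz defect. *)
Lemma CauchySchwarz_dotp n (x y : 'cV[R]_n) : `|dotp x y| <= enorm x * enorm y.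
Proof.
have [y0|y0] := eqVneq (dotp y y) 0.
  by rewrite (dotp_eq0 y0) dotpC dotp0l normr0 mulr_ge0 ?enorm_ge0.
have yy : 0 < dotp y y by rewrite lt_neqAle eq_sym y0 dotp_ge0.
rewrite -[leLHS]sqrtr_sqr -sqrtrM ?dotp_ge0// ler_sqrt; last first.
  by rewrite mulr_ge0 ?dotp_ge0.
have := dotp_ge0 (dotp y y *: x - dotp x y *: y).
rewrite !dotpE (dotpC y x) => h.
have : 0 <= dotp y y * (dotp x x * dotp y y - dotp x y ^+ 2) by nra.
by rewrite pmulr_rge0// subr_ge0.
Qed.

Lemma dotp_le n (x y : 'cV[R]_n) : dotp x y <= enorm x * enorm y.
Proof. exact: le_trans (ler_norm _) (CauchySchwarz_dotp _ _). Qed.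

Lemma ler_enormD n (x y : 'cV[R]_n) : enorm (x + y) <= enorm x + enorm y.
Proof.
rewrite -(@ler_pXn2r _ 2)// ?nnegrE ?addr_ge0 ?enorm_ge0//.
rewrite sqrrD !enorm_sqr !dotpE (dotpC y x).
by have := dotp_le x y; lra.
Qed.

Lemma entry_le_enorm n (x : 'cV[R]_n) i : `|x i 0| <= enorm x.
Proof.
rewrite -sqrtr_sqr ler_sqrt ?dotp_ge0// /dotp (bigD1 i)//= -expr2 lerDl.
by apply: sumr_ge0 => j _; rewrite -expr2 sqr_ge0.
Qed.

(** Cauchy-Schwarz on each row gives the Frobenius norm as a bound, so the supremum defining
    [opnorm] is a genuine one. *)
Lemma enorm_mulmx_bounded m n (M : 'M[R]_(m, n)) :
  exists C, forall x, enorm x <= 1 -> enorm (M *m x) <= C.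
Proof.
exists (Num.sqrt (\sum_i enorm (row i M)^T ^+ 2)) => x x1.
have MxE i : (M *m x) i 0 = dotp (row i M)^T x.
  by rewrite dotp_mxE trmxK -row_mul [RHS]mxE.
rewrite ler_sqrt ?sumr_ge0// => [|i _]; last exact: sqr_ge0.
apply: ler_sum => i _; rewrite MxE -expr2 -real_normK ?num_real//.
rewrite ler_pXn2r// ?nnegrE ?enorm_ge0//.
apply: (le_trans (CauchySchwarz_dotp _ _)).
by rewrite ler_piMr ?enorm_ge0.
Qed.

Lemma opnorm_has_sup m n (M : 'M[R]_(m, n)) :
  has_sup [set enorm (M *m x) | x in [set x : 'cV[R]_n | enorm x <= 1]].
Proof.
split; first by exists (enorm (M *m 0)), 0 => //=; rewrite enorm0.
by have [C MC] := enorm_mulmx_bounded M; exists C => _ [x /= x1 <-]; exact: MC.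
Qed.

Lemma opnorm_ge0 m n (M : 'M[R]_(m, n)) : 0 <= opnorm M.
Proof.
apply: (sup_upper_bound (opnorm_has_sup M)).
by exists 0; rewrite ?mulmx0 /= ?enorm0.
Qed.

Lemma enorm_mulmx_le m n (M : 'M[R]_(m, n)) x :
  enorm (M *m x) <= opnorm M * enorm x.
Proof.
have [/eqP x0|x0] := boolP (enorm x == 0).
  by rewrite (enorm_eq0 x0) mulmx0 !enorm0 mulr0.
have xp : 0 < enorm x by rewrite lt_neqAle eq_sym x0 enorm_ge0.
rewrite -ler_pdivrMr// mulrC -[X in X * _]ger0_norm ?invr_ge0 ?enorm_ge0//.
rewrite -enormZ scalemxAr; apply: (sup_upper_bound (opnorm_has_sup M)).
exists ((enorm x)^-1 *: x) => //=.
by rewrite enormZ ger0_norm ?invr_ge0 ?enorm_ge0// mulVf.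
Qed.

(** The square of [enorm (M^T *m x)] is the pairing of [M *m (M^T *m x)] with [x]; Cauchy-Schwarz
    and one cancellation conclude. *)
Lemma enorm_trmulmx_le m n (M : 'M[R]_(m, n)) x :
  enorm (M^T *m x) <= opnorm M * enorm x.
Proof.
have [/eqP->|Mx0] := boolP (enorm (M^T *m x) == 0).
  by rewrite mulr_ge0 ?opnorm_ge0 ?enorm_ge0.
have Mxp : 0 < enorm (M^T *m x) by rewrite lt_neqAle eq_sym Mx0 enorm_ge0.
rewrite -(ler_pM2l Mxp) -expr2 enorm_sqr -dotp_mull.
apply: (le_trans (dotp_le _ _)).
by rewrite mulrA ler_wpM2r ?enorm_ge0// mulrC enorm_mulmx_le.
Qed.

End euclidean.

(** * Limits along filters *)

Section limits.
Context {R : realType}.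

(** Compactness of the segment yields a cluster point, and an ultrafilter converges to each of its
    cluster points. *)
Lemma ultra_bounded_cvg T (U : set_system T) {UU : UltraFilter U}
    (x : T -> R) (M : R) :
  (forall t, `|x t| <= M) -> exists l : R, x @ U --> l.
Proof.
move=> xM; have xUM : (x @ U) `[- M, M]%classic.
  by apply: (@filterE _ U) => t; rewrite /= in_itv/= -ler_norml.
have [l [_ xl]] := segment_compact (fmap_proper_filter x _) xUM.
exists l => B lB; have [//|UC] := in_ultra_setVsetC (x @^-1` B) UU.
have [y [nBy By]] := xl (~` B) B UC lB.
by case: nBy.
Qed.

Lemma cvg_coordP T (F : set_system T) {FF : Filter F} n (x : T -> 'cV[R]_n)
    (l : 'cV[R]_n) :
  x @ F --> l <-> forall i, x t i 0 @[t --> F] --> l i 0.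
Proof.
split=> [xl i|xl].
  exact: (continuous_cvg _ (@coord_continuous R n 1 i 0 l) xl).
apply/cvgrPdist_lt => e e0.
have near_all : \forall t \near F, forall i, `|l i 0 - x t i 0| < e.
  by apply: filter_forall => i; have /cvgrPdist_lt/(_ e e0) := xl i.
apply: filterS near_all => t xte.
rewrite /Num.norm/= mx_normrE; apply/bigmax_ltP; split=> // -[i j] _ /=.
by rewrite ord1 !mxE.
Qed.

(** Bridge between the topology of the entrywise sup norm and the Euclidean norm. *)
Lemma cvg_enormP T (F : set_system T) {FF : Filter F} n (x : T -> 'cV[R]_n)
    (l : 'cV[R]_n) :
  x @ F --> l <-> enorm (x t - l) @[t --> F] --> (0 : R).
Proof.
split=> [/cvg_coordP xl|xl].
  rewrite -(sqrtr0 R); apply: continuous_cvg; first exact: sqrt_continuous.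
  have -> : (0 : R) = \sum_(i < n) (0 : R) by rewrite big1.
  apply: cvg_big => //= [p|i _]; first exact: add_continuous.
  rewrite -(mulr0 0).
  suff xi0 : (x t - l) i 0 @[t --> F] --> (0 : R) by exact: cvgM.
  under eq_fun do rewrite !mxE.
  by rewrite -(subrr (l i 0)); apply: cvgB; [exact: xl|exact: cvg_cst].
apply/cvg_coordP => i; apply/cvgrPdist_lt => e e0.
have /cvgr0_norm_lt/(_ e e0) := xl; apply: filterS => t.
rewrite ger0_norm ?enorm_ge0// distrC => /(le_lt_trans _); apply.
by have := entry_le_enorm (x t - l) i; rewrite !mxE.
Qed.

Lemma ultra_bounded_cvg_cV T (U : set_system T) {UU : UltraFilter U} n
    (x : T -> 'cV[R]_n) (M : R) :
  (forall t, enorm (x t) <= M) -> exists l : 'cV[R]_n, x @ U --> l.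
Proof.
move=> xM.
have /choice[l xl] : forall i, exists l : R, x t i 0 @[t --> U] --> l.
  move=> i; apply: (@ultra_bounded_cvg _ _ _ _ M) => t.
  exact: le_trans (entry_le_enorm _ _) _.
by exists (\col_i l i); apply/cvg_coordP => i; rewrite mxE.
Qed.

(** Otherwise some real [a] lies strictly between [rho] and [h l]: near [l] the values of [h] exceed
    [a], while [r] is eventually below it. *)
Lemma lsc_le_lim T (F : set_system T) {FF : ProperFilter F} n
    (h : 'cV[R]_n -> \bar R) (x : T -> 'cV[R]_n) (l : 'cV[R]_n)
    (r : T -> R) (rho : R) :
  lower_semicontinuous h -> x @ F --> l ->
  r @ F --> rho -> (\forall t \near F, (h (x t) <= (r t)%:E)%E) ->
  (h l <= rho%:E)%E.
Proof.
move=> hlsc xl rrho hr; rewrite leNgt; apply/negP => rhoh.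
have [a rhoa ah] : exists2 a, rho < a & (a%:E < h l)%E.
  case: (h l) rhoh => [y|_|//]; last by exists (rho + 1); rewrite ?ltrDl ?ltry.
  by rewrite lte_fin => /midf_lt[? ?]; exists ((rho + y) / 2); rewrite ?lte_fin.
have [V lV hV] := hlsc l a ah.
have xV : F (x @^-1` V) := xl _ lV.
have ra : F [set t | r t < a] by exact: cvgr_lt rrho _ rhoa.
have [t [[] htr rta /hV]] := filter_ex (filterI (filterI hr ra) xV).
by rewrite ltNge (le_trans htr)// lee_fin ltW.
Qed.

Lemma cvg_dotp T (F : set_system T) {FF : Filter F} n
    (x y : T -> 'cV[R]_n) (a b : 'cV[R]_n) :
  x @ F --> a -> y @ F --> b -> dotp (x t) (y t) @[t --> F] --> dotp a b.
Proof.
move=> /cvg_coordP xa /cvg_coordP yb; apply: cvg_big => [p|i _].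
  exact: add_continuous.
exact: cvgM.
Qed.

Lemma cvg_mulmx T (F : set_system T) {FF : Filter F} m n (M : 'M[R]_(m, n))
    (x : T -> 'cV[R]_n) (l : 'cV[R]_n) :
  x @ F --> l -> M *m x t @[t --> F] --> M *m l.
Proof.
move=> /cvg_coordP xl; apply/cvg_coordP => i.
under eq_fun do rewrite mxE.
rewrite mxE; apply: cvg_big => [p|j _]; first exact: add_continuous.
by apply: cvgM; [exact: cvg_cst|exact: xl].
Qed.

End limits.

(** * Subgradients and the proximal operator of the conjugate *)

Section subgradients.
Context {R : realType}.

(** Finiteness of [h w] is not part of the definition; for proper [h] it follows by testing at a
    point of the domain. *)
Definition subgrad n (h : 'cV[R]_n -> \bar R) (p w : 'cV[R]_n) : Prop :=
  forall z, (h w + (dotp p (z - w))%:E <= h z)%E.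

Lemma subgrad_fin n (h : 'cV[R]_n -> \bar R) p w :
  eproper h -> subgrad h p w -> exists r, h w = r%:E.
Proof.
move=> [hNy [z hz]] hpw; exists (fine (h w)); rewrite fineK// fin_numE hNy/=.
apply/negP => /eqP hw; have := hpw z.
by rewrite hw/= leye_eq => /eqP hzy; move: hz; rewrite /edom /= hzy ltxx.
Qed.

Lemma subgrad_monotone n (h : 'cV[R]_n -> \bar R) p w p' w' :
  eproper h -> subgrad h p w -> subgrad h p' w' -> 0 <= dotp (p - p') (w - w').
Proof.
move=> hp hpw hpw'.
have [r hw] := subgrad_fin hp hpw; have [r' hw'] := subgrad_fin hp hpw'.
have := hpw w'; have := hpw' w; rewrite hw hw' -!EFinD !lee_fin !dotpE; lra.
Qed.

Lemma enorm_le1D_sqr n (x : 'cV[R]_n) : enorm x <= 1 + enorm x ^+ 2.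
Proof. by have := sqr_ge0 (enorm x - 1); have := enorm_ge0 x; nra. Qed.

(** Direct method: the affine minorant makes the regularized function coercive, so a minimizing
    sequence is bounded, and lower semicontinuity passes to its limit. *)
Lemma exists_regularized_min n (h : 'cV[R]_n -> \bar R) (m g : R) p c :
  0 < g -> lower_semicontinuous h -> eproper h ->
  (forall z, ((m + dotp p z)%:E <= h z)%E) ->
  exists w r, h w = r%:E /\ forall z,
    ((r + g / 2 * enorm (w - c) ^+ 2)%:E
       <= h z + (g / 2 * enorm (z - c) ^+ 2)%:E)%E.
Proof.
move=> g0 hlsc [hNy [z0 hz0]] hm.
pose q z : R := g / 2 * enorm (z - c) ^+ 2.
pose S := [set r : R | exists z, (h z + (q z)%:E <= r%:E)%E].
(* Completing the square: the affine minorant plus the quadratic term equals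
   [K + g / 2 * enorm (z - a) ^+ 2]. *)
pose a := c - g^-1 *: p.
pose K := m + dotp p c - (2 * g)^-1 * dotp p p.
have low z r : (h z + (q z)%:E <= r%:E)%E ->
    K + g / 2 * enorm (z - a) ^+ 2 <= r.
  move=> /(le_trans (leeD2r _ (hm z))); rewrite -EFinD lee_fin; apply: le_trans.
  rewrite /q /K /a !enorm_sqr !dotpE (dotpC z p) (dotpC c p) (dotpC c z).
  rewrite le_eqVlt; apply/orP; left; apply/eqP; field.
  by rewrite gt_eqF.
have hS : has_inf S.
  split.
    move: hz0 (hNy z0); rewrite /edom /=; case hz0y: (h z0) => [y| |]// _ _.
    by exists (y + q z0), z0; rewrite hz0y.
  exists K => r [z /low]; apply: le_trans.
  by rewrite lerDl mulr_ge0 ?sqr_ge0// divr_ge0 ?ltW.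
have /choice[z zS] : forall k : nat, exists z,
    (h z + (q z)%:E <= (inf S + k.+1%:R^-1)%:E)%E.
  move=> k; have k0 : (0 : R) < k.+1%:R^-1 by rewrite invr_gt0.
  have [r [z hz] rlt] := inf_adherent k0 hS.
  by exists z; apply: (le_trans hz); rewrite lee_fin ltW.
have zbnd k : enorm (z k) <= 1 + 2 / g * (inf S + 1 - K) + enorm a.
  have k1 : (k.+1%:R^-1 : R) <= 1 by rewrite invf_le1 ?ler1n// ltr0n.
  have lk := low _ _ (zS k).
  have -> : z k = (z k - a) + a by rewrite subrK.
  apply: (le_trans (ler_enormD _ _)); rewrite lerD2r.
  apply: (le_trans (enorm_le1D_sqr _)); rewrite lerD2l.
  have -> : enorm (z k - a) ^+ 2 = 2 / g * (g / 2 * enorm (z k - a) ^+ 2).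
    by field; rewrite gt_eqF.
  rewrite ler_pM2l ?divr_gt0//; move: lk k1.
  by move: (_^-1) (_ * _) => e f; lra.
(* An ultrafilter finer than [\oo] plays the role of a convergent subsequence. *)
have [U [UU ooU]] := ultraFilterLemma (eventually_filter : ProperFilter \oo).
have [l zl] := ultra_bounded_cvg_cV (U := U) zbnd.
have ql : q (z k) @[k --> U] --> q l.
  apply: cvgM; first exact: cvg_cst.
  have zcl : z k - c @[k --> U] --> l - c by apply: cvgB => //; exact: cvg_cst.
  under eq_fun do rewrite enorm_sqr.
  by rewrite enorm_sqr; exact: cvg_dotp.
have hl : (h l <= (inf S - q l)%:E)%E.
  apply: (@lsc_le_lim _ _ U _ _ _ z l
    (fun k => inf S + k.+1%:R^-1 - q (z k))) => //.
    apply: cvgB => //; rewrite -[X in _ --> X]addr0; apply: cvgD => //.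
      exact: cvg_cst.
    by move=> B /(@cvg_harmonic R); exact: ooU.
  apply: filterE => k; rewrite EFinB leeBrDr//.
exists l, (fine (h l)).
have hlfin : h l = (fine (h l))%:E.
  by rewrite fineK// fin_numE hNy/= lt_eqF// (le_lt_trans hl) ?ltry.
split=> // x; move: hl; rewrite hlfin lee_fin lerBrDr -/(q l) -/(q x) => hl.
move: (hNy x); case hxy: (h x) => [y| |]// _; last by rewrite addye// leey.
rewrite -EFinD lee_fin; apply: (le_trans hl); apply: ge_inf; first exact: hS.2.
by exists x; rewrite hxy.
Qed.

End subgradients.

Section prox.
Context {R : realType}.

Lemma le_small_slope (a b c : R) :
  (forall t, 0 < t <= 1 -> a <= b + t * c) -> a <= b.
Proof.
move=> abc; rewrite leNgt; apply/negP => ba.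
have c0 := normr_ge0 c.
(* With this [t] the term [t * c] is at most half the gap [a - b], a contradiction. *)
pose t := Num.min 1 ((a - b) / (2 * (`|c| + 1))).
have t0 : 0 < t by rewrite lt_min ltr01 divr_gt0//; lra.
have t1 : t <= 1 by rewrite ge_min lexx.
have : t * (`|c| + 1) <= (a - b) / 2.
  have -> : (a - b) / 2 = (a - b) / (2 * (`|c| + 1)) * (`|c| + 1).
    by field; lra.
  by rewrite ler_pM2r ?ge_min ?lexx ?orbT//; lra.
have := abc t; rewrite t0 t1 => /(_ isT).
have := ler_norm c; nra.
Qed.

Lemma econvex_fin n (h : 'cV[R]_n -> \bar R) x y t rx ry :
  econvex h -> h x = rx%:E -> h y = ry%:E -> 0 <= t <= 1 ->
  (h (t *: x + (1 - t) *: y)%R <= (t * rx + (1 - t) * ry)%:E)%E.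
Proof. by move=> hc hx hy /(hc x y); rewrite hx hy -!EFinM -EFinD. Qed.

(** Compare [w] with the point [t *: z + (1 - t) *: w], divide by [t] and let [t] tend to 0. *)
Lemma regularized_min_subgrad n (h : 'cV[R]_n -> \bar R) g c w r :
  0 < g -> eproper h -> econvex h -> h w = r%:E ->
  (forall z, ((r + g / 2 * enorm (w - c) ^+ 2)%:E
       <= h z + (g / 2 * enorm (z - c) ^+ 2)%:E)%E) ->
  subgrad h (g *: (c - w)) w.
Proof.
move=> g0 [hNy _] hc hw wmin z; rewrite hw.
move: (hNy z); case hz: (h z) => [y| |]// _; last by rewrite leey.
rewrite -EFinD lee_fin.
apply: (@le_small_slope _ _ (g / 2 * dotp (z - w) (z - w))) => t /andP[t0 t1].
have t01 : 0 <= t <= 1 by rewrite ltW.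
have := wmin (t *: z + (1 - t) *: w).
move=> /le_trans/(_ (leeD2r _ (econvex_fin hc hz hw t01))).
rewrite -EFinD lee_fin.
have -> : t *: z + (1 - t) *: w - c = (w - c) + t *: (z - w).
  by apply/colP => i; rewrite !mxE; ring.
rewrite !enorm_sqr (dotpDl (w - c)) !(dotpDr _ (w - c)) !dotpZl !dotpZr.
have -> : dotp (z - w) (w - c) = - dotp (c - w) (z - w).
  by rewrite -dotpNl opprB dotpC.
have -> : dotp (w - c) (z - w) = - dotp (c - w) (z - w).
  by rewrite -dotpNl opprB.
move=> H.
rewrite -(ler_pM2l t0); lra.
Qed.

(* Moreau's decomposition: the prox of the conjugate is read off the minimizer
   [w] of [h + g/2 |. - a/g|^2], so that no biconjugation is needed. *)
Lemma prox_conjugate_subgrad n (h : 'cV[R]_n -> \bar R) (m g : R) q a :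
  0 < g -> lower_semicontinuous h -> eproper h -> econvex h ->
  (forall z, ((m + dotp q z)%:E <= h z)%E) ->
  subgrad h (prox g (conjugate h) a) (g^-1 *: (a - prox g (conjugate h) a)).
Proof.
move=> g0 hlsc hp hc hm.
have [w [r [hw wmin]]] := exists_regularized_min (g^-1 *: a) g0 hlsc hp hm.
have := regularized_min_subgrad g0 hp hc hw wmin.
set p := g *: (g^-1 *: a - w) => pw.
suff -> : prox g (conjugate h) a = p.
  suff -> : g^-1 *: (a - p) = w by [].
  by apply/colP => i; rewrite !mxE; field; rewrite gt_eqF.
pose quad u : R := (2 * g)^-1 * enorm (u - a) ^+ 2.
(* Fenchel-Young: the affine function [dotp v w - r] lies below the conjugate and touches it at
   [p]. *)
have cp : (conjugate h p <= (dotp p w - r)%:E)%E.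
  apply: ge_ereal_sup => _ [x _ <-]; have := pw x; rewrite hw.
  move: (hp.1 x); case: (h x) => [y| |]// _; last by rewrite addeNy leNye.
  by rewrite -EFinD -EFinB !lee_fin dotpDr dotpNr; lra.
have cv v : ((dotp v w - r)%:E <= conjugate h v)%E.
  by apply: ereal_sup_ubound; exists w; rewrite // hw.
(* Since [p = a - g *: w], the quadratic function on the left has its minimum at [p], with an
   explicit excess elsewhere. This excess makes [p] the unique minimizer. *)
have quadE v : dotp v w + quad v =
    dotp p w + quad p + (2 * g)^-1 * enorm (v - p) ^+ 2.
  have vE : v = p + (v - p) by rewrite subrKC.
  rewrite {1 2}vE; move: (v - p) => d; rewrite /quad.
  have -> : p + d - a = - g *: w + d.
    by apply/colP => i; rewrite !mxE; field; rewrite gt_eqF.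
  have -> : p - a = - g *: w.
    by apply/colP => i; rewrite !mxE; field; rewrite gt_eqF.
  rewrite !enorm_sqr !dotpE (dotpC w d); field.
  by rewrite gt_eqF.
have lowF v : ((dotp p w + quad p - r + (2 * g)^-1 * enorm (v - p) ^+ 2)%:E
    <= conjugate h v + (quad v)%:E)%E.
  apply: (le_trans _ (leeD2r _ (cv v))); rewrite -EFinD lee_fin.
  by have := quadE v; lra.
have upF : (conjugate h p + (quad p)%:E <= (dotp p w + quad p - r)%:E)%E.
  by apply: (le_trans (leeD2r _ cp)); rewrite -EFinD lee_fin; lra.
have i2g : 0 < (2 * g)^-1 by rewrite invr_gt0 mulr_gt0.
apply: xget_unique => [v|v vmin].
  apply: (le_trans upF); apply: (le_trans _ (lowF v)); rewrite lee_fin lerDl.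
  by rewrite mulr_ge0 ?sqr_ge0// ltW.
apply/eqP; rewrite -subr_eq0; apply/eqP/dotp_eq0/le_anti.
rewrite dotp_ge0 andbT -enorm_sqr.
have := le_trans (lowF v) (le_trans (vmin p) upF).
by rewrite lee_fin -[leRHS]addr0 lerD2l pmulr_rle0.
Qed.

End prox.

(** * Existence of dual solutions *)

Section dual_solution.
Context {R : realType} {n : nat}.
Variables (h : 'cV[R]_n -> \bar R) (c : 'cV[R]_n).
Hypotheses (h_proper : eproper h) (h_convex : econvex h).

(* A linear functional on a subspace is encoded by its graph, so that no
   well-definedness has to be checked when it is extended. *)
Definition linear_graph (G : set ('cV[R]_n * R)) : Prop :=
  forall a b z z' r r', G (z, r) -> G (z', r') ->
    G (a *: z + b *: z', a * r + b * r').

(** The domination hypothesis of the Hahn-Banach theorem, with [h (c + z) - r0] as the dominating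
    convex function. *)
Definition supported (r0 : R) (G : set ('cV[R]_n * R)) : Prop :=
  forall z r, G (z, r) -> ((r0 + r)%:E <= h (c + z)%R)%E.

Definition extend_graph (G : set ('cV[R]_n * R)) e a : set ('cV[R]_n * R) :=
  [set x | exists z r t, G (z, r) /\ x = (z + t *: e, r + t * a)].

Lemma edom_fin z : edom h z -> exists y, h z = y%:E.
Proof.
by rewrite /edom /=; move: (h_proper.1 z); case: (h z) => // y; exists y.
Qed.

Lemma relint_reflect x y : relint (edom h) x -> edom h y ->
  exists2 e, 0 < e & edom h (x + e *: (x - y)).
Proof.
move=> [hx [e e0 he]] hy.
(* Chosen so that [d * enorm (x - y) = e / 2 - d], which is less than [e]. The prolonged point is
   the affine combination of [x] and [y] with coefficients [1 + d] and [- d]. *)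
pose d := e / 2 / (1 + enorm (x - y)).
have N0 := enorm_ge0 (x - y).
have d0 : 0 < d by rewrite !divr_gt0//; lra.
exists d => //; apply: he.
  exists 2%N, (fun i => if i == ord0 then 1 + d else - d),
    (fun i => if i == ord0 then x else y); split.
  - by move=> i; case: ifP.
  - by rewrite !big_ord_recl big_ord0 /=; ring.
  - rewrite !big_ord_recl big_ord0 /=.
    by apply/colP => i; rewrite !mxE; ring.
rewrite addrC addKr enormZ gtr0_norm//.
have -> : d * enorm (x - y) = e / 2 - d by rewrite /d; field; lra.
lra.
Qed.

(** One-dimensional Hahn-Banach step: the value [a] on [e] has to separate the slopes of [h] in the
    direction [- e] from those in the direction [e]. *)
Lemma extend_supported r0 G e :
  linear_graph G -> supported r0 G ->
  (exists z r, G (z, r) /\ relint (edom h) (c + z)) ->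
  exists a, supported r0 (extend_graph G e a).
Proof.
move=> Glin Gsup [zs [rs [Gs rint]]].
(* For [sg = 1] these are the upper bounds that domination imposes on [a], for [sg = -1] the lower
   bounds. *)
pose slope (sg : R) : set R := [set l | exists z r t y, [/\ 0 < t, G (z, r),
  h (c + z + (sg * t) *: e) = y%:E & l = sg * (y - r0 - r) / t]].
have slope_mono l u : slope (-1) l -> slope 1 u -> l <= u.
  move=> [z1 [r1 [s [y1 [s0 G1 h1 ->]]]]] [z2 [r2 [t [y2 [t0 G2 h2 ->]]]]].
  have st0 : 0 < s + t by rewrite addr_gt0.
  (* The weights [t / (s + t)] and [s / (s + t)] cancel the component along [e], so that convexity
     can be compared with domination on [G]. *)
  have w01 : 0 <= t / (s + t) <= 1.
    apply/andP; split; first by rewrite divr_ge0// ltW.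
    by rewrite ler_pdivrMr//; lra.
  have := le_trans (Gsup _ _ (Glin (t / (s + t)) (s / (s + t)) _ _ _ _ G1 G2)).
  have -> : c + (t / (s + t) *: z1 + s / (s + t) *: z2) =
    t / (s + t) *: (c + z1 + (-1 * s) *: e)
    + (1 - t / (s + t)) *: (c + z2 + (1 * t) *: e).
    by apply/colP => i; rewrite !mxE; field; rewrite gt_eqF.
  move=> /(_ _ (econvex_fin h_convex h1 h2 w01)); rewrite lee_fin.
  rewrite -(ler_pM2l st0).
  have -> : (s + t) * (r0 + (t / (s + t) * r1 + s / (s + t) * r2)) =
    (s + t) * r0 + t * r1 + s * r2 by field; rewrite gt_eqF.
  have -> : (s + t) * (t / (s + t) * y1 + (1 - t / (s + t)) * y2) =
    t * y1 + s * y2 by field; rewrite gt_eqF.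
  by move=> H; rewrite ler_pdivrMr// mulrAC ler_pdivlMr//; lra.
(* The relative interior point makes both families of slopes nonempty as soon
   as one of them is; if both are empty, any value of [a] will do. *)
have slope_opp sg l : sg ^+ 2 = 1 -> slope sg l -> slope (- sg) !=set0.
  move=> sg2 [z [r [t [y [t0 Gz hy ly]]]]].
  have hdom : edom h (c + z + (sg * t) *: e) by rewrite /edom /= hy ltry.
  have [d d0 /edom_fin[y' hy']] := relint_reflect rint hdom.
  exists (- sg * (y' - r0 - ((1 + d) * rs + (- d) * r)) / (d * t)).
  exists ((1 + d) *: zs + (- d) *: z), ((1 + d) * rs + (- d) * r), (d * t), y'.
  split => //; [exact: mulr_gt0|exact: Glin|].
  rewrite -hy'; congr (h _); apply/colP => i; rewrite !mxE; ring.
pose a := sup (slope (-1)).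
exists a => _ _ [z [r [t [Gz [-> ->]]]]].
have [->|t0] := eqVneq t 0; first by rewrite scale0r mul0r !addr0; exact: Gsup.
rewrite (addrA c); move: (h_proper.1 (c + z + t *: e)).
case hy: (h _) => [y| |]// _; last by rewrite leey.
rewrite lee_fin; have [tneg|tpos] := ltP t 0.
  have slt : slope (-1) (-1 * (y - r0 - r) / (- t)).
    exists z, r, (- t), y; split; rewrite ?oppr_gt0// -hy.
    by congr (h (_ + _ *: _)); ring.
  have [u su] : slope 1 !=set0.
    by rewrite -[1]opprK; apply: slope_opp slt; rewrite sqrrN expr1n.
  have : -1 * (y - r0 - r) / (- t) <= a.
    apply: (sup_upper_bound _ slt); split; first by eexists; exact: slt.
    by exists u => l sl; exact: slope_mono.
  by rewrite ler_pdivrMr ?oppr_gt0//; lra.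
have {}tpos : 0 < t by rewrite lt_neqAle eq_sym t0.
have slt : slope 1 (1 * (y - r0 - r) / t).
  by exists z, r, t, y; split => //; rewrite mul1r.
have : a <= 1 * (y - r0 - r) / t.
  apply: ge_sup; last by move=> l sl; exact: slope_mono.
  by apply: slope_opp slt; rewrite expr1n.
by rewrite ler_pdivlMr//; lra.
Qed.

Lemma extend_graph_linear G e a :
  linear_graph G -> linear_graph (extend_graph G e a).
Proof.
move=> Glin x y z z' r r'.
move=> [z1 [r1 [t1 [G1 [-> ->]]]]] [z2 [r2 [t2 [G2 [-> ->]]]]].
exists (x *: z1 + y *: z2), (x * r1 + y * r2), (x * t1 + y * t2).
split; first exact: Glin.
congr pair; last by ring.
by apply/colP => i; rewrite !mxE; ring.
Qed.

Lemma extend_supported_seq r0 G (es : seq 'cV[R]_n) :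
  linear_graph G -> supported r0 G ->
  (exists z r, G (z, r) /\ relint (edom h) (c + z)) ->
  exists G', [/\ linear_graph G', supported r0 G', G `<=` G' &
    forall e, e \in es -> exists a, G' (e, a)].
Proof.
move=> + + [zs [rs [+ rint]]]; elim: es G => [|e es IH] G Glin Gsup Gs.
  by exists G; split.
have [a Gasup] := extend_supported e Glin Gsup
  (ex_intro _ zs (ex_intro _ rs (conj Gs rint))).
have GGa : G `<=` extend_graph G e a.
  by move=> [z r] Gz; exists z, r, 0; rewrite scale0r mul0r !addr0.
have [G' [G'lin G'sup GaG' G'es]] :=
  IH _ (@extend_graph_linear _ e a Glin) Gasup (GGa _ Gs).
exists G'; split => // [x /GGa /GaG'//|f]; rewrite inE => /orP[/eqP->|/G'es//].
exists a; apply: GaG'; exists 0, 0, 1; rewrite scale1r mul1r !add0r; split=> //.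
by have := Glin 0 0 _ _ _ _ Gs Gs; rewrite !scale0r !mul0r !addr0.
Qed.

(** Once the functional is extended to the canonical basis, its values there are the entries of
    [p]. *)
Lemma exists_subgrad_extension r0 G :
  linear_graph G -> supported r0 G -> h c = r0%:E ->
  (exists z r, G (z, r) /\ relint (edom h) (c + z)) ->
  exists2 p, subgrad h p c & forall z r, G (z, r) -> r = dotp p z.
Proof.
move=> Glin Gsup hc0 Grint.
have [G' [G'lin G'sup GG' G'e]] := extend_supported_seq
  [seq delta_mx i 0 | i <- enum 'I_n] Glin Gsup Grint.
have /choice[a G'a] : forall i : 'I_n, exists a, G' (delta_mx i 0, a).
  by move=> i; apply: G'e; apply/mapP; exists i; rewrite ?mem_enum.
pose p : 'cV[R]_n := \col_i a i.
have G'p z : G' (z, dotp p z).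
  have zE : z = \sum_(i < n) z i 0 *: delta_mx i 0.
    by rewrite {1}(matrix_sum_delta z); apply: eq_bigr => i _; rewrite big_ord1.
  rewrite [X in G' (X, _)]zE /dotp.
  elim/big_rec2: _ => [|i x r _ G'xr].
    have [zs [rs [/GG' Gs _]]] := Grint.
    by have := G'lin 0 0 _ _ _ _ Gs Gs; rewrite !scale0r !mul0r !addr0.
  have := G'lin (z i 0) 1 _ _ _ _ (G'a i) G'xr.
  by rewrite scale1r mul1r mxE mulrC.
exists p => [z|z r /GG' Gzr].
  by rewrite hc0; have := G'sup _ _ (G'p (z - c)); rewrite subrKC.
(* Single-valuedness of the graph: [G'] contains [(0, t * d)] for every real [t], and domination at
   0 forces [d = 0]. *)
pose d := r - dotp p z.
have G'd t : G' (0, t * d).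
  have := G'lin t (- t) _ _ _ _ Gzr (G'p z).
  by rewrite scaleNr subrr mulNr -mulrBr.
have dle t : t * d <= 0.
  by have := G'sup _ _ (G'd t); rewrite addr0 hc0 lee_fin gerDl.
by have := dle 1; have := dle (-1); rewrite /d; lra.
Qed.

End dual_solution.

(** * Optimality conditions: solutions and saddle points *)

Section optimality.
Context {R : realType}.

Lemma spd_unitmx n (M : 'M[R]_n) : spd M -> M \in unitmx.
Proof.
move=> [_ Mpos]; rewrite -row_free_unit -kermx_eq0; apply/eqP/row_matrixP => i.
rewrite row0; apply/eqP; apply: contraT => ui0.
have := Mpos (row i (kermx M))^T.
rewrite trmxK -row_mul mulmx_ker row0 mul0mx mxE.
rewrite ltxx; apply; apply: contra ui0 => /eqP u0.
by rewrite -[row i _]trmxK u0 trmx0.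
Qed.

(** The substitution [x = M *m y] turns this form into that of [M]. *)
Lemma invmx_spd_ge0 n (M : 'M[R]_n) x : spd M -> 0 <= dotp x (invmx M *m x).
Proof.
move=> Mspd; rewrite -{1}[x](mulKVmx (spd_unitmx Mspd)).
move: (invmx M *m x) => y; rewrite dotp_mull Mspd.1 dotp_mxE mulmxA.
have [->|y0] := eqVneq y 0; first by rewrite mulmx0 mxE.
exact: ltW (Mspd.2 _ y0).
Qed.

Lemma wnorm_invmx_sqr n (M : 'M[R]_n) x :
  spd M -> wnorm (invmx M) x ^+ 2 = dotp x (invmx M *m x).
Proof.
by move=> Mspd; rewrite /wnorm -mulmxA -dotp_mxE sqr_sqrtr// invmx_spd_ge0.
Qed.

Context {s d d' : nat}.
Variables (A : 'M[R]_(s, d)) (b : 'cV[R]_s) (S : 'M[R]_s) (W : 'M[R]_(d', d)).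
Variable h : 'cV[R]_d' -> \bar R.
Hypotheses (S_spd : spd S) (h_proper : eproper h) (h_convex : econvex h).

Let Q := A^T *m invmx S *m A.
Let grad u := A^T *m invmx S *m (A *m u - b).

Lemma invmx_sym : (invmx S)^T = invmx S.
Proof. by rewrite trmx_inv S_spd.1. Qed.

Lemma gram_sym : Q^T = Q.
Proof. by rewrite /Q !trmx_mul trmxK invmx_sym mulmxA. Qed.

Lemma gram_ge0 x : 0 <= dotp x (Q *m x).
Proof. by rewrite /Q -!mulmxA -[A^T]trmxK -dotp_mull trmxK invmx_spd_ge0. Qed.

Lemma weighted_lsq_expansion u x :
  2^-1 * wnorm (invmx S) (A *m (u + x) - b) ^+ 2 =
  2^-1 * wnorm (invmx S) (A *m u - b) ^+ 2 + dotp (grad u) x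
    + 2^-1 * dotp x (Q *m x).
Proof.
rewrite !wnorm_invmx_sqr// mulmxDr addrAC /grad /Q.
move: (A *m u - b) => r; rewrite -!mulmxA dotp_mull trmxK dotp_mull invmx_sym.
have -> : dotp x (A^T *m (invmx S *m (A *m x))) =
    dotp (A *m x) (invmx S *m (A *m x)) by rewrite dotp_mull.
move: (A *m x) => y; rewrite mulmxDr !dotpE.
have -> : dotp y (invmx S *m r) = dotp r (invmx S *m y).
  by rewrite dotpC dotp_mull invmx_sym.
by field.
Qed.

(** Stationarity cancels the linear terms of the expansion and of the subgradient inequality; the
    remaining quadratic term is nonnegative. *)
Lemma saddle_is_argmin u v :
  subgrad h v (W *m u) -> grad u + W^T *m v = 0 ->
  is_argmin (pnpd_objective A b S W h) u.
Proof.
move=> hv gv y; rewrite /pnpd_objective.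
have -> : y = u + (y - u) by rewrite subrKC.
move: (y - u) => x; rewrite weighted_lsq_expansion.
have := hv (W *m (u + x)); have [r ->] := subgrad_fin h_proper hv.
move: (h_proper.1 (W *m (u + x))).
case: (h (W *m (u + x))) => [t| |]// _; last by move=> _; rewrite addey// leey.
rewrite -!EFinD !lee_fin {1}mulmxDr addrAC subrr add0r.
have -> : dotp v (W *m x) = - dotp (grad u) x.
  rewrite dotpC dotp_mull -dotpNl dotpC; congr dotp.
  by apply/eqP; rewrite -addr_eq0 addrC gv.
have := gram_ge0 x; lra.
Qed.

(** First-order optimality along a segment. It is the domination hypothesis for the functional
    sending [W *m x] to [- dotp (grad u) x] on the range of [W]. *)
Lemma argmin_directional u x r0 :
  is_argmin (pnpd_objective A b S W h) u -> h (W *m u) = r0%:E ->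
  ((r0 - dotp (grad u) x)%:E <= h (W *m u + W *m x)%R)%E.
Proof.
move=> umin hu; move: (h_proper.1 (W *m u + W *m x)).
case hux: (h _) => [y| |]// _; last by rewrite leey.
rewrite lee_fin lerBlDr.
apply: (@le_small_slope _ _ _ (2^-1 * dotp x (Q *m x))) => t /andP[t0 t1].
have t01 : 0 <= t <= 1 by rewrite ltW.
have hconv := econvex_fin h_convex hux hu t01.
have WE : t *: (W *m u + W *m x) + (1 - t) *: (W *m u) = W *m (u + t *: x).
  by rewrite mulmxDr -scalemxAr; apply/colP => i; rewrite !mxE; ring.
rewrite WE in hconv.
have := le_trans (umin (u + t *: x)) (leeD2l _ hconv).
rewrite /pnpd_objective hu => H.
rewrite (weighted_lsq_expansion u (t *: x)) -!EFinD lee_fin in H.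
have QZ : Q *m (t *: x) = t *: (Q *m x) by rewrite scalemxAr.
rewrite QZ !dotpZr dotpZl in H.
by rewrite -(ler_pM2l t0); lra.
Qed.

Lemma argmin_saddle u :
  (exists ustar : 'cV[R]_d, relint (edom h) (W *m ustar)) ->
  is_argmin (pnpd_objective A b S W h) u ->
  exists2 v, subgrad h v (W *m u) & grad u + W^T *m v = 0.
Proof.
move=> [us rint] umin.
have [r0 hu] : exists r, h (W *m u) = r%:E.
  have [y hy] := edom_fin h_proper rint.1.
  have := umin us; rewrite /pnpd_objective hy; move: (h_proper.1 (W *m u)).
  by case: (h (W *m u)) => // r _ _; exists r.
pose G : set ('cV[R]_d' * R) :=
  [set z | exists x, z = (W *m x, - dotp (grad u) x)].
have Glin : linear_graph G.
  move=> k l _ _ _ _ [x [-> ->]] [y [-> ->]]; exists (k *: x + l *: y).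
  by rewrite mulmxDr -!scalemxAr !dotpE; congr pair; ring.
have Gsup : supported h (W *m u) r0 G.
  by move=> _ _ [x [-> ->]]; exact: argmin_directional.
have [|v hv vG] := exists_subgrad_extension h_proper h_convex Glin Gsup hu.
  exists (W *m (us - u)), (- dotp (grad u) (us - u)).
  by split; [exists (us - u)|rewrite -mulmxDr subrKC].
(* The functional represented by [v] is tested on the stationarity defect [w] itself, which gives
   [dotp w w = 0]. *)
exists v => //; pose w := grad u + W^T *m v; apply: (@dotp_eq0 _ _ w).
have vGw := vG (W *m w) (- dotp (grad u) w) (ex_intro _ w erefl).
by rewrite {1}/w dotpDl dotp_mull trmxK -vGw addrN.
Qed.

End optimality.

(** * Quasi-Fejer monotonicity *)

Section nested_step.
Context {R : realType} {d d' : nat}.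
Variables (Q : 'M[R]_d) (W : 'M[R]_(d', d)) (alpha beta : R).
Hypotheses (Q_sym : Q^T = Q) (Q_ge0 : forall x, 0 <= dotp x (Q *m x)).
Hypothesis alphaQ : forall x, alpha * dotp x (Q *m x) <= dotp x x.
Hypotheses (alpha_gt0 : 0 < alpha) (beta_gt0 : 0 < beta).

(** Quadratic form of [alpha ^+ 2 *: (beta^-1 I - W W^T)]; it is positive definite once
    [beta * opnorm W ^+ 2 < 1]. *)
Definition dual_sqnorm (y : 'cV[R]_d') : R :=
  alpha ^+ 2 / beta * dotp y y - alpha ^+ 2 * dotp (W^T *m y) (W^T *m y).

Lemma dual_sqnorm_ge y :
  alpha ^+ 2 * (beta^-1 - opnorm W ^+ 2) * dotp y y <= dual_sqnorm y.
Proof.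
have WTy : dotp (W^T *m y) (W^T *m y) <= opnorm W ^+ 2 * dotp y y.
  rewrite -!enorm_sqr -exprMn.
  rewrite ler_pXn2r ?nnegrE ?mulr_ge0 ?opnorm_ge0 ?enorm_ge0//.
  exact: enorm_trmulmx_le.
have := ler_wpM2l (sqr_ge0 alpha) WTy; rewrite /dual_sqnorm; lra.
Qed.

(** The saddle point is translated to the origin, which makes the gradient the linear map [Q]; the
    third hypothesis is monotonicity of the subdifferential. Half of the squared distance from [x']
    to [xb] absorbs the cross term in [Q], whence the factor [2^-1]. *)
Lemma nested_step xb x x' y y' :
  x = xb - alpha *: (Q *m xb) - alpha *: (W^T *m y) ->
  x' = xb - alpha *: (Q *m xb) - alpha *: (W^T *m y') ->
  0 <= dotp y' ((alpha / beta) *: (y - y') + W *m x) ->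
  dotp x' x' + dual_sqnorm y' + (dual_sqnorm (y' - y)
    + 2^-1 * dotp (x' - xb) (x' - xb)) <= dotp xb xb + dual_sqnorm y.
Proof.
move=> xE x'E mono.
have Wx : dotp y' (W *m x) = dotp (W^T *m y') x by rewrite dotp_mull trmxK.
have {xE} xE : x = x' + alpha *: (W^T *m y' - W^T *m y).
  by rewrite xE x'E; apply/colP => i; rewrite !mxE; ring.
have : 0 <= 2 * alpha *
    dotp y' ((alpha / beta) *: (y - y') + W *m x).
  by rewrite mulr_ge0// mulr_ge0// ltW.
rewrite dotpDr Wx xE !dotpE => {}mono.
(* Polarization: the left-hand side is twice the inner product of [y'] and [y' - y] associated with
   [dual_sqnorm]. *)
have fejer : dual_sqnorm y' + dual_sqnorm (y' - y) - dual_sqnorm y <=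
    2 * (alpha * dotp (W^T *m y') x').
  rewrite /dual_sqnorm mulmxBr !dotpE (dotpC y y') (dotpC (W^T *m y)).
  lra.
have dualE : alpha * dotp (W^T *m y') x' =
    dotp xb x' - alpha * dotp (Q *m xb) x' - dotp x' x'.
  have aWE : alpha *: (W^T *m y') = xb - alpha *: (Q *m xb) - x'.
    by rewrite [in RHS]x'E; apply/colP => i; rewrite !mxE; ring.
  by rewrite -dotpZl aWE !dotpE.
rewrite dualE in fejer.
(* Together: [- 4 alpha <Q xb, x'> <= |x' - xb|^2]. *)
have := alphaQ (x' - xb); have := Q_ge0 (x' + xb).
rewrite !mulmxDr !mulmxN !dotpE (dotpC xb x').
have -> : dotp x' (Q *m xb) = dotp (Q *m xb) x' by exact: dotpC.
have -> : dotp xb (Q *m x') = dotp (Q *m xb) x' by rewrite dotp_mull Q_sym.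
move=> /(ler_wpM2l (ltW alpha_gt0)); rewrite (dotpC xb x') in fejer.
lra.
Qed.

End nested_step.

(** * Real sequences decreasing up to a summable error *)

Section quasi_fejer.
Context {R : realType}.
Variables E eps : R^nat.
Hypotheses (E_ge0 : forall n, 0 <= E n) (eps_ge0 : forall n, 0 <= eps n).
Hypothesis eps_summable : cvgn (series eps).

(** Subtracting the partial sums of [eps] leaves a nonincreasing sequence, bounded below by minus
    the total sum. *)
Lemma quasi_fejer_cvg : (forall n, E n.+1 <= E n + eps n) -> cvgn E.
Proof.
move=> EE.
have -> : E = (fun n => (E n - series eps n) + series eps n).
  by apply/funext => n; rewrite subrK.
apply: is_cvgD => //; apply: nonincreasing_is_cvgn.
  apply/nonincreasing_seqP => n; have := EE n.
  by rewrite seriesSr; lra.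
exists (- limn (series eps)) => _ [n _ <-].
have : series eps n <= limn (series eps).
  apply: nondecreasing_cvgn_le => //; apply/nondecreasing_seqP => k.
  by rewrite seriesSr lerDl.
by have := E_ge0 n; lra.
Qed.

(** The residual is squeezed between 0 and a difference of two sequences with the same limit. *)
Lemma quasi_fejer_residual (r : R^nat) :
  (forall n, 0 <= r n) ->
  (forall n, E n.+1 ^+ 2 + r n <= (E n + eps n) ^+ 2) ->
  cvgn E /\ r @ \oo --> (0 : R).
Proof.
move=> r0 EE.
have Ecvg : cvgn E.
  apply: quasi_fejer_cvg => n.
  rewrite -(@ler_pXn2r _ 2)// ?nnegrE ?addr_ge0//.
  by apply: le_trans (EE n); rewrite lerDl.
split=> //; have eps0 := cvg_series_cvg_0 eps_summable.
apply: (@squeeze_cvgr _ _ _ _ (fun=> 0)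
  (fun n => (E n + eps n) ^+ 2 - E n.+1 ^+ 2)).
- by apply: nearW => n; rewrite r0 lerBrDl EE.
- exact: cvg_cst.
have -> : (0 : R) = (limn E + 0) * (limn E + 0) - limn E * limn E by ring.
apply: cvgB; first by apply: cvgM; exact: cvgD.
by apply: cvgM; rewrite cvg_shiftS.
Qed.

End quasi_fejer.

(** * Averaging, telescoping and closedness of the subdifferential *)

Section auxiliary.
Context {R : realType}.

(** Jensen's inequality for the squared norm, from the nonnegativity of the variance around the mean
    [m]. *)
Lemma mean_sqnorm_le n (K : nat) (x : nat -> 'cV[R]_n) : (0 < K)%N ->
  K%:R * dotp (K%:R^-1 *: \sum_(1 <= j < K.+1) x j)
              (K%:R^-1 *: \sum_(1 <= j < K.+1) x j) <=
  \sum_(1 <= j < K.+1) dotp (x j) (x j).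
Proof.
move=> K0; have KR : (K%:R : R) != 0 by rewrite pnatr_eq0 -lt0n.
set m := _ *: _; have Sm : \sum_(1 <= j < K.+1) x j = K%:R *: m.
  by rewrite /m scalerA divff// scale1r.
clearbody m.
have : 0 <= \sum_(1 <= j < K.+1) dotp (x j - m) (x j - m).
  by apply: sumr_ge0 => j _; exact: dotp_ge0.
rewrite (eq_bigr (fun j => dotp (x j) (x j) + -2 * dotp (x j) m + dotp m m)).
  rewrite !big_split/= -mulr_sumr -dotp_suml Sm dotpZl sumr_const_nat subn1.
  by rewrite -[_ *+ _]mulr_natl; lra.
by move=> j _; rewrite !dotpE (dotpC m); ring.
Qed.

(** Only the residual of the first inner step is kept; the limit argument uses no other. *)
Lemma telescoped_sum_le (a D r : nat -> R) b K :
  (forall j, (j < K.+1)%N -> a j.+1 + D j.+1 + r j <= b + D j) ->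
  (forall j, 0 <= r j) ->
  \sum_(1 <= j < K.+2) a j + D K.+1 + r 0%N <= K.+1%:R * b + D 0%N.
Proof.
move=> + r0; elim: K => [|K IH] H.
  by rewrite big_nat1 mul1r; exact: H.
rewrite big_nat_recr//= -[in leRHS]natr1.
have := IH (fun j jK => H j (ltnW jK)); have := H K.+1 (leqnn _).
by have := r0 K.+1; move: (K.+1%:R) (\sum_(_ <= _ < _) _) => k t; lra.
Qed.

(** Triangle inequality for the norm [sqrt (K a^2 + D)]: moving [a] by [e] costs [sqrt K * e]. *)
Lemma sqrt_shift (K a e D : R) : 0 <= K -> 0 <= a -> 0 <= e -> 0 <= D ->
  K * (a + e) ^+ 2 + D <= (Num.sqrt (K * a ^+ 2 + D) + Num.sqrt K * e) ^+ 2.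
Proof.
move=> K0 a0 e0 D0; have KaD : 0 <= K * a ^+ 2 + D.
  by rewrite addr_ge0// mulr_ge0// sqr_ge0.
have le : Num.sqrt K * a <= Num.sqrt (K * a ^+ 2 + D).
  by rewrite -{1}(ger0_norm a0) -sqrtr_sqr -sqrtrM// ler_sqrt// lerDl.
rewrite (sqrrD (Num.sqrt (_ + _))) sqr_sqrtr// exprMn sqr_sqrtr//.
have := ler_wpM2r (mulr_ge0 (sqrtr_ge0 K) e0) le.
have -> : Num.sqrt K * a * (Num.sqrt K * e) = K * (a * e).
  by rewrite mulrACA -expr2 sqr_sqrtr.
by lra.
Qed.

(** For [x = 0] the extended inverse is [+oo] and bounds nothing, but then the product vanishes. *)
Lemma le_inve_mul_le1 (a x : R) : 0 <= x -> (a%:E <= x%:E^-1)%E -> a * x <= 1.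
Proof.
move=> x0; have [->|xn0] := eqVneq x 0; first by rewrite mulr0.
have xp : 0 < x by rewrite lt_neqAle eq_sym xn0.
by rewrite inver (negbTE xn0) lee_fin -[x^-1]mul1r ler_pdivlMr.
Qed.

Lemma lt_inve_mul_lt1 (a x : R) : 0 <= x -> (a%:E < x%:E^-1)%E -> a * x < 1.
Proof.
move=> x0; have [->|xn0] := eqVneq x 0; first by rewrite mulr0.
have xp : 0 < x by rewrite lt_neqAle eq_sym xn0.
by rewrite inver (negbTE xn0) lte_fin -[x^-1]mul1r ltr_pdivlMr.
Qed.

Lemma cvg_sqnorm0 T (F : set_system T) {FF : Filter F} n
    (z : T -> 'cV[R]_n) (c : R) (r : T -> R) :
  0 < c -> (forall t, c * dotp (z t) (z t) <= r t) -> r @ F --> (0 : R) ->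
  z @ F --> (0 : 'cV[R]_n).
Proof.
move=> c0 zr r0; apply/cvg_enormP.
under eq_fun do rewrite subr0.
rewrite -(sqrtr0 R); apply: continuous_cvg; first exact: sqrt_continuous.
apply: (@squeeze_cvgr _ _ _ _ (fun=> 0) (fun t => c^-1 * r t)).
- apply: filterE => t; rewrite dotp_ge0/= mulrC ler_pdivlMr// mulrC; exact: zr.
- exact: cvg_cst.
by rewrite -(mulr0 c^-1); apply: cvgM => //; exact: cvg_cst.
Qed.

(** For fixed [z], the subgradient inequality bounds [h (w t)] by a convergent real function, to
    which lower semicontinuity applies. *)
Lemma subgrad_closed T (F : set_system T) {FF : ProperFilter F} n
    (h : 'cV[R]_n -> \bar R) (p w : T -> 'cV[R]_n) (p0 w0 : 'cV[R]_n) :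
  eproper h -> lower_semicontinuous h -> (forall t, subgrad h (p t) (w t)) ->
  p @ F --> p0 -> w @ F --> w0 -> subgrad h p0 w0.
Proof.
move=> hp hlsc hpw pp0 ww0 z; move: (hp.1 z).
case hz: (h z) => [y| |]// _; last by rewrite leey.
have : (h w0 <= (y - dotp p0 (z - w0))%:E)%E.
  apply: (@lsc_le_lim _ _ F _ _ _ w w0
    (fun t => y - dotp (p t) (z - w t))) => //.
    apply: cvgB; first exact: cvg_cst.
    by apply: cvg_dotp => //; apply: cvgB => //; exact: cvg_cst.
  apply: filterE => t; have := hpw t z; rewrite hz.
  have [r ->] := subgrad_fin hp (hpw t).
  by rewrite -EFinD !lee_fin; lra.
move: (hp.1 w0); case: (h w0) => [r| |]// _.
by rewrite -EFinD !lee_fin; lra.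
Qed.

End auxiliary.

(** * Convergence of the iteration *)

Section pnpd.
Context {R : realType} {s d d' : nat}.
Variables (A : 'M[R]_(s, d)) (b : 'cV[R]_s) (h : 'cV[R]_d' -> \bar R).
Variables (W : 'M[R]_(d', d)) (S : 'M[R]_s) (P : 'M[R]_d) (alpha beta : R).
Variables (kmax : nat) (gam : nat -> R).
Variables (u : nat -> 'cV[R]_d) (v : nat -> nat -> 'cV[R]_d').
Hypotheses (h_proper : eproper h) (h_convex : econvex h).
Hypothesis h_lsc : lower_semicontinuous h.
Hypotheses (S_spd : spd S) (PAS : invmx P *m A^T = A^T *m invmx S).
Hypotheses (alpha_gt0 : 0 < alpha) (beta_gt0 : 0 < beta).
Hypothesis alpha_le : alpha * opnorm (invmx P *m A^T *m A) <= 1.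
Hypothesis beta_lt : beta * opnorm W ^+ 2 < 1.
Hypothesis kmax_ge1 : (1 <= kmax)%N.
Hypothesis gam_ge0 : forall n, 0 <= gam n.
Hypothesis uv_pnpd : pnpd_sequence A b W h P alpha beta kmax gam u v.
Hypothesis inertia_summable :
  cvgn (series (fun n => gam n * enorm (u n - u n.-1))).

Let Q := A^T *m invmx S *m A.
Let grad x := A^T *m invmx S *m (A *m x - b).
Let bar := pnpd_bar gam u.
Let inner := pnpd_inner A b W P alpha gam u v.
Let D := dual_sqnorm W alpha beta.
Let sg := beta / alpha.
(** The point where the proximal step makes [v n k.+1] a subgradient of [h]; it differs from
    [W *m inner n k] by a multiple of the dual increment. *)
Let w n k := sg^-1 *: (v n k + sg *: (W *m inner n k) - v n k.+1).
Let res n := D (v n 1%N - v n 0%N)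
  + 2^-1 * dotp (inner n 1%N - bar n) (inner n 1%N - bar n).
Let eps n := Num.sqrt kmax%:R * (gam n * enorm (u n - u n.-1)).

Definition saddle_point x y := subgrad h y (W *m x) /\ grad x + W^T *m y = 0.

Definition energy x y n :=
  Num.sqrt (kmax%:R * enorm (u n - x) ^+ 2 + D (v n 0%N - y)).

Let sg_gt0 : 0 < sg. Proof. exact: divr_gt0. Qed.

Let c := alpha ^+ 2 * (beta^-1 - opnorm W ^+ 2).

Let c_gt0 : 0 < c.
Proof.
rewrite mulr_gt0 ?exprn_gt0// subr_gt0 -[beta^-1]mul1r ltr_pdivlMr//.
by rewrite mulrC.
Qed.

Let D_ge y : c * dotp y y <= D y.
Proof. exact: dual_sqnorm_ge. Qed.

Let D_ge0 y : 0 <= D y.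
Proof. by apply: le_trans (D_ge y); rewrite mulr_ge0 ?dotp_ge0// ltW. Qed.

(** [PAS] identifies [Q] with [invmx P *m A^T *m A], whose operator norm controls the quadratic form
    by Cauchy-Schwarz. *)
Let alphaQ x : alpha * dotp x (Q *m x) <= dotp x x.
Proof.
have Qx : enorm (Q *m x) <= opnorm Q * enorm x by exact: enorm_mulmx_le.
have : dotp x (Q *m x) <= opnorm Q * enorm x ^+ 2.
  apply: (le_trans (dotp_le _ _)); rewrite mulrC expr2 mulrA.
  by rewrite ler_wpM2r ?enorm_ge0.
move=> /(ler_wpM2l (ltW alpha_gt0))/le_trans; apply.
rewrite mulrA -enorm_sqr ler_piMl ?sqr_ge0//.
by move: alpha_le; rewrite PAS.
Qed.

Let innerE n k :
  inner n k = bar n - alpha *: grad (bar n) - alpha *: (W^T *m v n k).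
Proof. by rewrite /inner /pnpd_inner /pnpd_half /grad_lsq mulmxA PAS. Qed.

Let gradB x y : grad x - grad y = Q *m (x - y).
Proof.
by rewrite /grad /Q -mulmxBr -[RHS]mulmxA [A *m (x - y)]mulmxBr opprB subrKA.
Qed.

Section saddle.
Variables (x : 'cV[R]_d) (y : 'cV[R]_d').
Hypothesis xy : saddle_point x y.

Lemma dual_step_subgrad n k : (k < kmax)%N -> subgrad h (v n k.+1) (w n k).
Proof.
move=> kK; have [r hr] := subgrad_fin h_proper xy.1.
(* The affine minorant required of [h] is the one given by the subgradient [y] at the saddle
   point. *)
rewrite /w [v n k.+1](pnpd_dual_step uv_pnpd)//.
apply: (@prox_conjugate_subgrad _ _ _ (r - dotp y (W *m x)) _ y) => // z.
by apply: le_trans (xy.1 z); rewrite hr -EFinD lee_fin dotpDr dotpNr; lra.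
Qed.

Lemma inner_step n k : (k < kmax)%N ->
  dotp (inner n k.+1 - x) (inner n k.+1 - x) + D (v n k.+1 - y)
    + (D (v n k.+1 - v n k)
       + 2^-1 * dotp (inner n k.+1 - bar n) (inner n k.+1 - bar n)) <=
  dotp (bar n - x) (bar n - x) + D (v n k - y).
Proof.
move=> kK.
have innerx j : inner n j - x =
    (bar n - x) - alpha *: (Q *m (bar n - x)) - alpha *: (W^T *m (v n j - y)).
  rewrite innerE -gradB mulmxBr.
  have -> : W^T *m y = - grad x.
    by apply/eqP; rewrite -addr_eq0 addrC xy.2.
  by apply/colP => i; rewrite !mxE; ring.
have -> : v n k.+1 - v n k = (v n k.+1 - y) - (v n k - y).
  by rewrite opprB subrKA.
have -> : inner n k.+1 - bar n = (inner n k.+1 - x) - (bar n - x).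
  by rewrite opprB subrKA.
apply: (@nested_step _ _ _ Q W alpha beta (gram_sym _ S_spd)
  (gram_ge0 _ S_spd) alphaQ alpha_gt0 _ _ _ _ _ (innerx k) (innerx k.+1)).
have := subgrad_monotone h_proper (dual_step_subgrad n kK) xy.1.
congr (0 <= dotp _ _); rewrite /w /sg (mulmxBr W (inner n k) x).
move: (W *m inner n k) (W *m x) => p q; apply/colP => i; rewrite !mxE; field.
by rewrite !gt_eqF.
Qed.

(** All inner steps start from the same [bar n], hence [kmax] copies of its distance after
    summation; averaging the inner iterates is handled by Jensen's inequality. *)
Lemma outer_step n :
  kmax%:R * enorm (u n.+1 - x) ^+ 2 + D (v n.+1 0%N - y) + res n <=
  kmax%:R * enorm (bar n - x) ^+ 2 + D (v n 0%N - y).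
Proof.
have [K kmaxE] : exists K, kmax = K.+1 by exists kmax.-1; rewrite prednK.
have r0 j : 0 <= D (v n j.+1 - v n j)
    + 2^-1 * dotp (inner n j.+1 - bar n) (inner n j.+1 - bar n).
  by rewrite addr_ge0// mulr_ge0 ?dotp_ge0.
have := @telescoped_sum_le _
  (fun j => dotp (inner n j - x) (inner n j - x)) (fun j => D (v n j - y)) _
  (dotp (bar n - x) (bar n - x)) K.
rewrite -kmaxE => /(_ _ (fun j => @inner_step n j) r0); rewrite !enorm_sqr.
apply: le_trans; rewrite (pnpd_dual_next uv_pnpd) !lerD2r.
have -> : u n.+1 - x =
    kmax%:R^-1 *: \sum_(1 <= j < kmax.+1) (inner n j - x).
  have -> : u n.+1 = kmax%:R^-1 *: \sum_(1 <= j < kmax.+1) inner n j.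
    exact: pnpd_primal_next uv_pnpd n.
  move: (inner n) => f; rewrite sumrB scalerBr sumr_const_nat subn1.
  rewrite -[x *+ kmax]scaler_nat scalerA mulVf ?scale1r//.
  by rewrite pnatr_eq0 -lt0n.
exact: mean_sqnorm_le.
Qed.

Lemma energy_step n :
  energy x y n.+1 ^+ 2 + res n <= (energy x y n + eps n) ^+ 2.
Proof.
have K0 : 0 <= (kmax%:R : R) by [].
rewrite sqr_sqrtr; last by rewrite addr_ge0// mulr_ge0// sqr_ge0.
apply: (le_trans (outer_step n)).
apply: le_trans (sqrt_shift _ _ _ _); rewrite ?mulr_ge0 ?enorm_ge0//.
rewrite lerD2r ler_wpM2l// ler_pXn2r ?nnegrE ?addr_ge0 ?mulr_ge0 ?enorm_ge0//.
have -> : bar n - x = (u n - x) + gam n *: (u n - u n.-1).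
  by rewrite /bar /pnpd_bar addrAC.
by apply: (le_trans (ler_enormD _ _)); rewrite enormZ ger0_norm.
Qed.

Lemma energy_cvg_residual_cvg0 : cvgn (energy x y) /\ res @ \oo --> (0 : R).
Proof.
apply: (@quasi_fejer_residual _ _ eps).
- by move=> n; exact: sqrtr_ge0.
- by move=> n; rewrite !mulr_ge0 ?sqrtr_ge0 ?enorm_ge0.
- have -> : series eps = (fun n => Num.sqrt kmax%:R *
      series (fun n => gam n * enorm (u n - u n.-1)) n).
    by apply/funext => n; rewrite /series/= -mulr_sumr.
  by apply: is_cvgM => //; exact: is_cvg_cst.
- by move=> n; rewrite addr_ge0// mulr_ge0 ?dotp_ge0.
- exact: energy_step.
Qed.

Lemma le_energy n : enorm (u n - x) <= energy x y n.
Proof.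
have K1 : 1 <= (kmax%:R : R) by rewrite ler1n.
rewrite -(@ler_pXn2r _ 2)// ?nnegrE ?enorm_ge0 ?sqrtr_ge0//.
have e0 := sqr_ge0 (enorm (u n - x)).
rewrite /energy [leRHS]sqr_sqrtr; last by rewrite addr_ge0// mulr_ge0// ler0n.
by have := D_ge0 (v n 0%N - y); nra.
Qed.

Lemma le_energy_dual n : c * enorm (v n 0%N - y) ^+ 2 <= energy x y n ^+ 2.
Proof.
rewrite enorm_sqr /energy sqr_sqrtr; last first.
  by rewrite addr_ge0// mulr_ge0// sqr_ge0.
by apply: (le_trans (D_ge _)); rewrite lerDr mulr_ge0// sqr_ge0.
Qed.

Lemma pnpd_bounded :
  exists M : R, forall n, enorm (u n) <= M /\ enorm (v n 0%N) <= M.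
Proof.
have [/cvg_seq_bounded[B [_ HB]] _] := energy_cvg_residual_cvg0.
have EB n : energy x y n <= B + 1.
  by apply: (le_trans (ler_norm _)); apply: HB => //=; rewrite ltrDl.
have B0 : 0 <= B + 1 by apply: le_trans (EB 0%N); exact: sqrtr_ge0.
(* The dual energy controls a squared norm, turned into a bound on the norm by [enorm_le1D_sqr];
   this is the origin of the leading 1 in [M2]. *)
pose M1 := B + 1 + enorm x; pose M2 := 1 + (B + 1) ^+ 2 / c + enorm y.
exists (Num.max M1 M2) => n; rewrite !le_max; split; apply/orP; [left|right].
  rewrite -[u n](subrK x); apply: (le_trans (ler_enormD _ _)); rewrite lerD2r.
  exact: le_trans (le_energy n) (EB n).
rewrite -[v n 0%N](subrK y); apply: (le_trans (ler_enormD _ _)); rewrite lerD2r.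
apply: (le_trans (enorm_le1D_sqr _)); rewrite lerD2l ler_pdivlMr// mulrC.
apply: (le_trans (le_energy_dual n)).
by rewrite ler_pXn2r// nnegrE sqrtr_ge0.
Qed.

Lemma pnpd_ultra_limit (U : set_system nat) {UU : UltraFilter U} :
  \oo `<=` U -> exists x1 y1, [/\ saddle_point x1 y1,
    u @ U --> (x1 : 'cV[R]_d) & v n 0%N @[n --> U] --> (y1 : 'cV[R]_d')].
Proof.
move=> ooU; have [M uvM] := pnpd_bounded.
have [x1 ux1] := ultra_bounded_cvg_cV (U := U) (fun n => (uvM n).1).
have [y1 vy1] := ultra_bounded_cvg_cV (U := U) (fun n => (uvM n).2).
exists x1, y1; split=> //.
have res0 : res @ U --> (0 : R).
  by have [_ r0] := energy_cvg_residual_cvg0; move=> B /r0; exact: ooU.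
have inertia0 : gam n *: (u n - u n.-1) @[n --> U] --> (0 : 'cV[R]_d).
  apply/cvg_enormP; under eq_fun do rewrite subr0 enormZ ger0_norm//.
  by have e0 := cvg_series_cvg_0 inertia_summable; move=> B /e0; exact: ooU.
have barx1 : bar @ U --> x1.
  by rewrite -[x1]addr0; apply: cvgD.
have dv0 : v n 1%N - v n 0%N @[n --> U] --> (0 : 'cV[R]_d').
  apply: (cvg_sqnorm0 c_gt0 _ res0) => n; apply: (le_trans (D_ge _)).
  by rewrite lerDl mulr_ge0 ?dotp_ge0.
have v1y1 : v n 1%N @[n --> U] --> y1.
  have -> : (fun n => v n 1%N) = (fun n => (v n 1%N - v n 0%N) + v n 0%N).
    by apply/funext => n; rewrite subrK.
  by rewrite -[y1]add0r; apply: cvgD.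
have du0 : inner n 1%N - bar n @[n --> U] --> (0 : 'cV[R]_d).
  apply: (cvg_sqnorm0 (c := 2^-1) _ _ res0); first by rewrite invr_gt0.
  by move=> n; rewrite lerDr.
have gradx1 : grad (bar n) @[n --> U] --> grad x1.
  apply: cvg_mulmx; apply: cvgB; first exact: cvg_mulmx.
  exact: cvg_cst.
have scalev (k : nat) y0 : v n k @[n --> U] --> (y0 : 'cV[R]_d') ->
    inner n k @[n --> U] --> x1 - alpha *: grad x1 - alpha *: (W^T *m y0).
  move=> vky0; have -> : inner ^~ k = fun n =>
      bar n - alpha *: grad (bar n) - alpha *: (W^T *m v n k).
    by apply/funext => n; exact: innerE.
  apply: cvgB; first by apply: cvgB => //; apply: cvgZ => //; exact: cvg_cst.
  by apply: cvgZ; [exact: cvg_cst|exact: cvg_mulmx].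
(* The limit of [inner n 1 - bar n] is 0 by the residual, and [- alpha] times the stationarity
   defect by the formula for the inner iterates. *)
have stat : grad x1 + W^T *m y1 = 0.
  have : x1 - alpha *: grad x1 - alpha *: (W^T *m y1) - x1 = 0.
    apply: (@cvg_unique _ _ (inner n 1%N - bar n @[n --> U])) => //.
    by apply: cvgB => //; exact: scalev.
  move: (grad x1) (W^T *m y1) => p q.
  have -> : x1 - alpha *: p - alpha *: q - x1 = - alpha *: (p + q).
    by apply/colP => i; rewrite !mxE; ring.
  by move=> /eqP; rewrite scaler_eq0 oppr_eq0 gt_eqF//= => /eqP.
(* The residual does not involve [inner n 0]; its limit comes from that of [v n 0] together with
   stationarity. *)
have innerx1 : inner n 0%N @[n --> U] --> x1.
  have -> : x1 = x1 - alpha *: grad x1 - alpha *: (W^T *m y1).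
    by rewrite -addrA -opprD -scalerDr stat scaler0 subr0.
  exact: scalev.
split=> //.
apply: (@subgrad_closed _ _ U _ _ _
  (fun n => v n 1%N) (fun n => w n 0%N)) => //.
  by move=> n; exact: dual_step_subgrad.
have -> : W *m x1 = sg^-1 *: (y1 + sg *: (W *m x1) - y1).
  by rewrite addrAC subrr add0r scalerA mulVf ?scale1r// gt_eqF.
apply: cvgZ; first exact: cvg_cst.
apply: cvgB => //; apply: cvgD => //; apply: cvgZ; first exact: cvg_cst.
exact: cvg_mulmx.
Qed.

End saddle.

Lemma pnpd_cvg x y : saddle_point x y ->
  exists2 x1 : 'cV[R]_d, (exists y1, saddle_point x1 y1) &
    u n @[n --> \oo] --> x1.
Proof.
move=> xy.
have [U [UU ooU]] := ultraFilterLemma (eventually_filter : ProperFilter \oo).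
have [x1 [y1 [xy1 ux1 vy1]]] := pnpd_ultra_limit xy ooU.
exists x1; first by exists y1.
(* The limit point itself becomes the reference saddle point: the energy converges along [\oo], so
   its limit may be computed along [U], where it is 0. *)
have [Ecvg _] := energy_cvg_residual_cvg0 xy1.
have EU : energy x1 y1 @ U --> limn (energy x1 y1).
  by move=> B /Ecvg; exact: ooU.
have E0 : energy x1 y1 @ U --> (0 : R).
  rewrite -(sqrtr0 R); apply: continuous_cvg; first exact: sqrt_continuous.
  have -> : (0 : R) = kmax%:R * dotp (x1 - x1) (x1 - x1) +
      (alpha ^+ 2 / beta * dotp (y1 - y1) (y1 - y1) -
       alpha ^+ 2 * dotp (W^T *m (y1 - y1)) (W^T *m (y1 - y1))).
    by rewrite !subrr mulmx0 !dotp0l !mulr0 subr0 addr0.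
  have ux : u n - x1 @[n --> U] --> x1 - x1.
    by apply: cvgB => //; exact: cvg_cst.
  have vy : v n 0%N - y1 @[n --> U] --> y1 - y1.
    by apply: cvgB => //; exact: cvg_cst.
  under eq_fun do rewrite enorm_sqr.
  apply: cvgD; first by apply: cvgM; [exact: cvg_cst|exact: cvg_dotp].
  apply: cvgB; (apply: cvgM; first exact: cvg_cst); first exact: cvg_dotp.
  by apply: cvg_dotp; exact: cvg_mulmx.
have lim0 : limn (energy x1 y1) = 0.
  exact: (@cvg_unique _ _ (energy x1 y1 @ U)).
rewrite lim0 in Ecvg.
apply/cvg_enormP; apply: (@squeeze_cvgr _ _ _ _ (fun=> 0) (energy x1 y1)) => //.
  by apply: nearW => n; rewrite enorm_ge0 le_energy.
exact: cvg_cst.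
Qed.

End pnpd.

(** * From the stated hypotheses to the convergence result *)

Lemma nneseries_lty_cvg (R : realType) (a : nat -> R) :
  (forall n, 0 <= a n) -> (\sum_(0 <= n <oo) (a n)%:E < +oo)%E ->
  cvgn (series a).
Proof.
move=> a0 asum; apply: nondecreasing_is_cvgn.
  by apply/nondecreasing_seqP => n; rewrite seriesSr lerDl.
have a0E n : (0 <= n)%N -> true -> (0 <= (a n)%:E)%E by rewrite lee_fin.
exists (fine (\sum_(0 <= n <oo) (a n)%:E)) => _ [n _ <-].
rewrite -lee_fin fineK; first by rewrite -sumEFin; exact: nneseries_lim_ge.
by rewrite ge0_fin_numE// nneseries_ge0.
Qed.

Theorem theorem3 (R : realType) (s d d' : nat)
    (A : 'M[R]_(s, d)) (b : 'cV[R]_s)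
    (h : 'cV[R]_d' -> \bar R) (W : 'M[R]_(d', d))
    (S : 'M[R]_s) (P : 'M[R]_d)
    (alpha beta : R) (kmax : nat) (gam : nat -> R)
    (u : nat -> 'cV[R]_d) (v : nat -> nat -> 'cV[R]_d')
    (h_proper : eproper h) (h_convex : econvex h)
    (h_lsc : lower_semicontinuous h)
    (h_qualif : exists ustar : 'cV[R]_d, relint (edom h) (W *m ustar))
    (S_spd : spd S) (P_spd : spd P)
    (PAS : invmx P *m A^T = A^T *m invmx S)
    (solvable : exists x : 'cV[R]_d, is_argmin (pnpd_objective A b S W h) x)
    (alpha_gt0 : 0 < alpha)
    (alpha_le : (alpha%:E <= (opnorm (invmx P *m A^T *m A))%:E^-1)%E)
    (beta_gt0 : 0 < beta)
    (beta_lt : (beta%:E < (opnorm W ^+ 2)%:E^-1)%E)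
    (kmax_ge1 : (1 <= kmax)%N)
    (gam_ge0 : forall n, 0 <= gam n)
    (uv_pnpd : pnpd_sequence A b W h P alpha beta kmax gam u v)
    (inertia_summable :
      (\sum_(0 <= n <oo) (gam n * enorm (u n - u n.-1))%:E < +oo)%E) :
  (exists M : R, forall n, enorm (u n) <= M /\ enorm (v n 0%N) <= M) /\
  (exists2 x : 'cV[R]_d, is_argmin (pnpd_objective A b S W h) x &
     u n @[n --> \oo] --> x).
Proof.
have gnorm_ge0 n : 0 <= gam n * enorm (u n - u n.-1).
  by rewrite mulr_ge0 ?enorm_ge0.
have inertia_cvg := nneseries_lty_cvg gnorm_ge0 inertia_summable.
have alpha_le1 := le_inve_mul_le1 (opnorm_ge0 _) alpha_le.
have beta_lt1 := lt_inve_mul_lt1 (sqr_ge0 _) beta_lt.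
have [x0 x0min] := solvable.
(* Solvability and the relative interior condition provide the saddle point on which the energy
   estimates rest. *)
have [y0 hy0 gy0] := argmin_saddle S_spd h_proper h_convex h_qualif x0min.
have sad : saddle_point A b h W S x0 y0 by [].
split.
  exact: (pnpd_bounded h_proper h_convex h_lsc S_spd PAS alpha_gt0
    beta_gt0 alpha_le1 beta_lt1 kmax_ge1 gam_ge0 uv_pnpd inertia_cvg sad).
have [x1 [y1 [hy1 gy1]] ux1] :
    exists2 x1 : 'cV[R]_d, (exists y1, saddle_point A b h W S x1 y1) &
      u n @[n --> \oo] --> x1.
  exact: (pnpd_cvg h_proper h_convex h_lsc S_spd PAS alpha_gt0
    beta_gt0 alpha_le1 beta_lt1 kmax_ge1 gam_ge0 uv_pnpd inertia_cvg sad).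
by exists x1 => //; exact: saddle_is_argmin hy1 gy1.
Qed.
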